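(* Let $h$ be either a square-free ordinary polynomial in $\mathcal{W}(q)$ (with $q$ a power of a prime $p$), or a square-free polynomial in $\mathcal{W}(p)$ with no real roots (with $q=p$ prime). Let $K=\mathbb{Q}[x]/(h)$, $\alpha = x \bmod (h)$, and let $R=\mathbb{Z}[\alpha,q/\alpha]$. Then there is an equivalence of categories $\Psi\colon \mathcal{M}(h)\to \mathcal{I}(R)$.
   Context: Let $q=p^r$ be a prime power. $\mathcal{W}(q)$ is the set of finite products of polynomials $h\in\mathbb{Q}[x]$ satisfying: (a) $h$ is monic, of even degree, with integer coefficients; (b) every complex root of $h$ has absolute value $\sqrt q$; (c) $h=m^n$ with $m$ irreducible and $n$ the least common denominator of the rational numbers $v_p(f(0))/r$, where $f$ runs over the irreducible factors of $m$ over $\mathbb{Q}_p$ and $v_p$ is the $p$-adic valuation with $v_p(q)=r$ (if $m$ has a real root, $1/2$ is added to this set of rational numbers). By Honda–Tate theory, $\mathcal{W}(q)$ is the set of characteristic polynomials of Frobenius of abelian varieties over $\mathbb{F}_q$. A polynomial $h\in\mathcal{W}(q)$ is ordinary if exactly half of its roots are $p$-adic units. Objects of $\mathcal{M}(h)$: pairs $(T,F)$ where $T$ is a finitely generated free $\mathbb{Z}$-module and $F$ is an endomorphism of $T$ such that $F\otimes\mathbb{Q}$ acts semisimply on $T\otimes_{\mathbb{Z}}\mathbb{Q}$, the characteristic polynomial of $F\otimes\mathbb{Q}$ is $h$, and there is an endomorphism $V$ of $T$ with $F\circ V=q$. A morphism $(T,F)\to(T',F')$ is a $\mathbb{Z}$-linear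 map $\varphi\colon T\to T'$ with $\varphi\circ F=F'\circ\varphi$. (This is the image of the isogeny class of abelian varieties over $\mathbb{F}_q$ with characteristic polynomial $h$ under the equivalence of Deligne, for $h$ ordinary, or of Centeleghe–Stix, for $q=p$ and $h$ without real roots.) The ring $R$ is an order in the étale $\mathbb{Q}$-algebra $K$. A fractional $R$-ideal is a finitely generated sub-$R$-module $I$ of $K$ with $I\otimes_{\mathbb{Z}}\mathbb{Q}=K$ (equivalently, containing a non-zero-divisor of $K$). $\mathcal{I}(R)$ is the category of fractional $R$-ideals with $R$-linear morphisms. *)

(* Defs.v *)
From HB Require Import structures.
From mathcomp Require Import all_boot all_order all_algebra all_field.
From mathcomp Require Import boolp classical_sets.

Set Implicit Arguments.
Unset Strict Implicit.
Unset Printing Implicit Defensive.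

Import Order.TTheory GRing.Theory Num.Theory.
Local Open Scope ring_scope.

(** * Categories, functors, equivalences *)

Record category := Category {
  obj :> Type;
  hom : obj -> obj -> Type;
  idm : forall X, hom X X;
  comp : forall X Y Z, hom Y Z -> hom X Y -> hom X Z;
  comp_idl : forall X Y (f : hom X Y), comp (idm Y) f = f;
  comp_idr : forall X Y (f : hom X Y), comp f (idm X) = f;
  compA : forall X Y Z W (f : hom Z W) (g : hom Y Z) (h : hom X Y),
    comp f (comp g h) = comp (comp f g) h }.

Arguments idm {c} X.

Record functor (C D : category) := Functor {
  fobj :> C -> D;
  fmap : forall X Y, hom X Y -> hom (fobj X) (fobj Y);
  fmap_id : forall X, fmap (idm X) = idm (fobj X);
  fmap_comp : forall X Y Z (g : hom Y Z) (f : hom X Y),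
    fmap (comp g f) = comp (fmap g) (fmap f) }.

Program Definition functor_id (C : category) : functor C C :=
  @Functor C C (fun X => X) (fun X Y f => f) _ _.

Program Definition functor_comp (C D E : category)
    (G : functor D E) (F : functor C D) : functor C E :=
  @Functor C E (fun X => G (F X)) (fun X Y f => fmap G (fmap F f)) _ _.
Next Obligation. by intros; rewrite !fmap_id. Qed.
Next Obligation. by intros; rewrite !fmap_comp. Qed.

Definition is_iso (C : category) (X Y : C) (f : hom X Y) : Prop :=
  exists g : hom Y X, comp g f = idm X /\ comp f g = idm Y.

Definition naturally_isomorphic (C D : category) (F G : functor C D) : Prop :=
  exists eta : forall X, hom (F X) (G X),
    (forall X, is_iso (eta X)) /\
    (forall X Y (f : hom X Y),
        comp (eta Y) (fmap F f) = comp (fmap G f) (eta X)).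

Definition is_equivalence (C D : category) (F : functor C D) : Prop :=
  exists G : functor D C,
    naturally_isomorphic (functor_comp G F) (functor_id C) /\
    naturally_isomorphic (functor_comp F G) (functor_id D).

(** * The p-adic integers and the p-adic numbers *)

(* Z_p is the inverse limit of the Z/p^n: an element is a sequence (x n) of
   representatives with 0 <= x n < p ^ n and x n.+1 = x n modulo p ^ n. *)

Definition coherent (p : nat) (x : nat -> nat) : Prop :=
  forall n, (x n.+1 %% p ^ n)%N = x n.

Record padic_int (p : nat) (p_pr : prime p) := PadicInt {
  residue : nat -> nat;
  residueP : `[< coherent p residue >] }.

Section PadicInt.
Variables (p : nat) (p_pr : prime p).
Local Notation padic_int := (padic_int p_pr).

HB.instance Definition _ := [isSub for @residue p p_pr].
HB.instance Definition _ := [Choice of padic_int by <:].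

Lemma padic_pX_gt0 n : (0 < p ^ n)%N.
Proof. by rewrite expn_gt0 prime_gt0. Qed.

Lemma padic_intP (x y : padic_int) :
  (forall n, residue x n = residue y n) -> x = y.
Proof. by move=> xy; apply/val_inj/funext. Qed.

Lemma residue_mod (x : padic_int) n : (residue x n %% p ^ n)%N = residue x n.
Proof. by case: x => x /= /asboolP xc; rewrite -(xc n) modn_mod. Qed.

Lemma residueS (x : padic_int) n : (residue x n.+1 %% p ^ n)%N = residue x n.
Proof. by case: x => x /= /asboolP; apply. Qed.

Lemma residueD (x : padic_int) n m :
  (residue x (m + n) %% p ^ n)%N = residue x n.
Proof.
elim: m => [|m IH]; first by rewrite residue_mod.
rewrite addSn -[RHS]IH -[in RHS](residueS x (m + n)) modn_dvdm //.
by rewrite dvdn_exp2l // leq_addl.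
Qed.

Lemma padic_subproof (f : nat -> nat) :
  (forall n, f n.+1 = f n %[mod p ^ n]) ->
  `[< coherent p (fun n => f n %% p ^ n)%N >].
Proof.
move=> fP; apply/asboolP => n.
by rewrite modn_dvdm ?fP // expnS dvdn_mull.
Qed.

Definition padic_of f fP := @PadicInt p p_pr _ (@padic_subproof f fP).

Lemma padic_nat_subproof (k n : nat) : k = k %[mod p ^ n].
Proof. by []. Qed.

Lemma padic_add_subproof (x y : padic_int) n :
  (residue x n.+1 + residue y n.+1 = residue x n + residue y n %[mod p ^ n])%N.
Proof. by rewrite -modnDm !residueS. Qed.

Lemma padic_mul_subproof (x y : padic_int) n :
  (residue x n.+1 * residue y n.+1 = residue x n * residue y n %[mod p ^ n])%N.
Proof. by rewrite -modnMm !residueS. Qed.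

Lemma padic_opp_subproof (x : padic_int) n :
  ((p ^ n.+1).-1 * residue x n.+1 = (p ^ n).-1 * residue x n %[mod p ^ n])%N.
Proof.
rewrite -[in RHS]residueS modnMmr -[LHS]modnMml -[RHS]modnMml.
congr ((_ * _) %% _)%N; apply/eqP.
rewrite -(eqn_modDr 1) !addn1 !prednK ?padic_pX_gt0 // expnS modnMl modnn //.
Qed.

Definition padic_zero := padic_of (padic_nat_subproof 0).
Definition padic_one := padic_of (padic_nat_subproof 1).
Definition padic_add x y := padic_of (padic_add_subproof x y).
Definition padic_mul x y := padic_of (padic_mul_subproof x y).
Definition padic_opp x := padic_of (padic_opp_subproof x).

Lemma padic_addA : associative padic_add.
Proof. by move=> x y z; apply: padic_intP => n /=; rewrite modnDml modnDmr addnA. Qed.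
Lemma padic_addC : commutative padic_add.
Proof. by move=> x y; apply: padic_intP => n /=; rewrite addnC. Qed.
Lemma padic_add0 : left_id padic_zero padic_add.
Proof. by move=> x; apply: padic_intP => n /=; rewrite mod0n add0n residue_mod. Qed.
Lemma padic_addN : left_inverse padic_zero padic_opp padic_add.
Proof.
move=> x; apply: padic_intP => n /=; rewrite modnDml -mulSnr prednK ?padic_pX_gt0 //.
by rewrite modnMr mod0n.
Qed.

HB.instance Definition _ := GRing.isZmodule.Build padic_int padic_addA padic_addC padic_add0 padic_addN.

Lemma padic_mulA : associative padic_mul.
Proof. by move=> x y z; apply: padic_intP => n /=; rewrite modnMml modnMmr mulnA. Qed.
Lemma padic_mulC : commutative padic_mul.
Proof. by move=> x y; apply: padic_intP => n /=; rewrite mulnC. Qed.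
Lemma padic_mul1 : left_id padic_one padic_mul.
Proof. by move=> x; apply: padic_intP => n /=; rewrite modnMml mul1n residue_mod. Qed.
Lemma padic_mulD : left_distributive padic_mul padic_add.
Proof.
move=> x y z; apply: padic_intP => n /=.
by rewrite modnMml mulnDl modnDm.
Qed.
Lemma padic_one_neq0 : padic_one != padic_zero.
Proof.
apply/eqP => /(congr1 (fun z : padic_int => residue z 1)) /=.
by rewrite expn1 mod0n modn_small // prime_gt1.
Qed.

HB.instance Definition _ :=
  GRing.Zmodule_isComNzRing.Build padic_int padic_mulA padic_mulC padic_mul1 padic_mulD padic_one_neq0.

Definition padic_unit : pred padic_int := fun x => `[< exists y, y * x = 1 >].
Definition padic_inv (x : padic_int) : padic_int :=
  xget x [set y | y * x = 1]%classic.

Lemma padic_mulVx : {in padic_unit, left_inverse 1 padic_inv *%R}.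
Proof. by move=> x /asboolP[y xy]; rewrite /padic_inv; case: xgetP => [//|/(_ y)]. Qed.
Lemma padic_unitPl (x y : padic_int) : y * x = 1 -> padic_unit x.
Proof. by move=> xy; apply/asboolP; exists y. Qed.
Lemma padic_inv_out : {in [predC padic_unit], padic_inv =1 id}.
Proof.
move=> x /asboolPn xN; rewrite /padic_inv; case: xgetP => // y _ xy.
by case: xN; exists y.
Qed.

HB.instance Definition _ :=
  GRing.ComNzRing_hasMulInverse.Build padic_int padic_mulVx (@padic_unitPl)
    padic_inv_out.

Lemma padic_neq0 (x : padic_int) : x != 0 -> exists n, residue x n <> 0%N.
Proof.
move=> x0; apply: contrapT => xN; move/eqP: x0; apply; apply: padic_intP => n.
by rewrite /= mod0n; apply: contrapT => xn; apply: xN; exists n.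
Qed.

Lemma padic_integral_axiom (x y : padic_int) : x * y = 0 -> (x == 0) || (y == 0).
Proof.
move=> xy; apply/norP => -[/padic_neq0[a xa] /padic_neq0[b yb]].
have nd (z : padic_int) k l : residue z k <> 0%N ->
    (0 < residue z (l + k) /\ logn p (residue z (l + k)) < k)%N.
  move=> zk; have zdvd : ~~ (p ^ k %| residue z (l + k))%N.
    by apply/negP => /eqP; rewrite residueD.
  have z0 : (0 < residue z (l + k))%N.
    by case: posnP zdvd => // ->; rewrite dvdn0.
  by split; rewrite // ltnNge -pfactor_dvdn.
have [x0 xl] := nd x a b xa; have [y0 yl] := nd y b a yb.
rewrite addnC in x0 xl.
have := congr1 (fun z : padic_int => residue z (a + b)) xy; rewrite /= mod0n => /eqP.
change (p ^ (a + b) %| residue x (a + b) * residue y (a + b) -> False)%N.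
rewrite pfactor_dvdn ?muln_gt0 ?x0 // lognM //.
by apply/negP; rewrite -ltnNge -addSn leq_add // ltnW.
Qed.

HB.instance Definition _ :=
  GRing.ComUnitRing_isIntegral.Build padic_int (@padic_integral_axiom).

Definition padic := {fraction padic_int}.
HB.instance Definition _ := GRing.Field.on padic.

Definition of_padic_int (x : padic_int) : padic := tofrac x.

(* The valuation with v_p(p) = 1; the value at 0 is the junk value 0. *)
Definition vp (x : padic) : int :=
  xget 0 [set k : int | exists2 u : padic_int, u \is a GRing.unit &
                          x = p%:R ^ k * of_padic_int u]%classic.

(* Units of the ring of integers of a finite extension L of Q_p, the ring of
   integers being the integral closure of Z_p in L. *)
Definition is_padic_unit (L : fieldExtType padic) (x : L) : Prop :=
  let iota (a : padic_int) : L := in_alg L (of_padic_int a) in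
  exists y : L, [/\ x * y = 1, integralOver iota x & integralOver iota y].

End PadicInt.

(** * Weil polynomials *)

(* algC contains all the complex roots of a polynomial with rational
   coefficients. *)
Definition has_real_root (f : {poly rat}) : Prop :=
  exists2 z : algC, z \is Num.real & root (map_poly ratr f) z.

Definition is_least_common_denominator (n : nat) (S : set rat) : Prop :=
  let is_denominator (k : nat) :=
    (0 < k)%N /\ forall x, S x -> k%:R * x \is a Num.int in
  is_denominator n /\ forall k, is_denominator k -> (n <= k)%N.

Section Weil.
Variables (p : nat) (p_pr : prime p) (r : nat).

(* The factors f are monic, so that v_p(f(0)) is well defined. *)
Definition slopes (m : {poly rat}) : set rat :=
  [set x | (exists f : {poly padic p_pr},
              [/\ f \is monic, irreducible_poly f, f %| map_poly ratr m &
                  x = (vp f.[0])%:~R / r%:R])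
           \/ (has_real_root m /\ x = 2^-1)]%classic.

Definition is_simple_weil (h : {poly rat}) : Prop :=
  [/\ [/\ h \is monic, ~~ odd (size h).-1 & h \is a polyOver Num.int],
      forall z : algC, root (map_poly ratr h) z -> `|z| = sqrtC (p ^ r)%:R &
      exists (m : {poly rat}) (n : nat),
        [/\ irreducible_poly m, is_least_common_denominator n (slopes m) &
            h = m ^+ n]].

Definition weil : set {poly rat} :=
  [set h | exists2 s : seq {poly rat},
             {in s, forall g, is_simple_weil g} & h = \prod_(g <- s) g]%classic.

(* The roots, with multiplicity, are taken in a finite extension of Q_p over
   which h splits. *)
Definition ordinary (h : {poly rat}) : Prop :=
  exists (L : fieldExtType (padic p_pr)) (rs : seq L),
    map_poly (in_alg L) (map_poly ratr h) = \prod_(x <- rs) ('X - x%:P) /\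
    ((count (fun x => `[< is_padic_unit x >]) rs).*2 = size rs)%N.

End Weil.

Definition square_free (h : {poly rat}) : Prop :=
  forall d : {poly rat}, d ^+ 2 %| h -> size d = 1%N.

(** * The category M(h) *)

(* T (x) Q is identified with the row vectors 'rV[rat]_n through a Z-basis b of
   T, and F (x) Q with the matrix A of F in this basis, acting on the right. *)
Definition semisimple_mx (n : nat) (A : 'M[rat]_n) : Prop :=
  forall U : 'M[rat]_n, stablemx U A ->
    exists W : 'M[rat]_n,
      [/\ stablemx W A, (U + W :=: 1%:M)%MS & (U :&: W)%MS = 0].

Record frob_module (q : nat) (h : {poly rat}) := FrobModule {
  fm_sort :> zmodType;
  frob : {additive fm_sort -> fm_sort};
  frobP : exists (n : nat) (b : {additive 'rV[int]_n -> fm_sort}) (A : 'M[int]_n),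
    [/\ bijective b, forall v, frob (b v) = b (v *m A),
        semisimple_mx (map_mx intr A) & char_poly (map_mx intr A) = h];
  verP : exists V : {additive fm_sort -> fm_sort}, forall t, frob (V t) = t *+ q }.

Lemma additive_eq (U V : zmodType) (f g : {additive U -> V}) : f =1 g -> f = g.
Proof.
case: f => f [[fa]]; case: g => g [[ga]] /= /funext fg; subst g.
by rewrite (Prop_irrelevance ga fa).
Qed.

Section FrobModuleCategory.
Variables (q : nat) (h : {poly rat}).
Implicit Types M : frob_module q h.

Record fm_hom M M' := FmHom {
  fm_fun :> {additive M -> M'};
  fm_homP : forall t, fm_fun (frob M t) = frob M' (fm_fun t) }.

Lemma fm_hom_eq M M' (f g : fm_hom M M') : f =1 g -> f = g.
Proof.
case: f => f fP; case: g => g gP /= /additive_eq fg; subst g.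
by rewrite (Prop_irrelevance gP fP).
Qed.

Program Definition fm_id M : fm_hom M M := @FmHom M M idfun _.
Program Definition fm_comp M1 M2 M3 (g : fm_hom M2 M3) (f : fm_hom M1 M2) :
  fm_hom M1 M3 := @FmHom M1 M3 (g \o f) _.
Next Obligation. by intros; rewrite /= !fm_homP. Qed.

Program Definition frob_module_cat : category :=
  @Category (frob_module q h) fm_hom fm_id fm_comp _ _ _.
Next Obligation. by intros; apply: fm_hom_eq. Qed.
Next Obligation. by intros; apply: fm_hom_eq. Qed.
Next Obligation. by intros; apply: fm_hom_eq. Qed.

End FrobModuleCategory.

(** * The algebra K = Q[x]/(h) *)

(* {poly %/ h} is not used because it is Q[x]/(x) when h is constant, whereas
   the empty product h = 1 belongs to W(q) and gives the zero ring. *)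

Section QuotientAlgebra.
Variable h : {poly rat}.

Definition multiples : {pred {poly rat}} := [pred f | h %| f].

Lemma multiples_zmod_closed : zmod_closed multiples.
Proof. by split=> [|f g]; rewrite !inE ?dvdp0 //; apply: dvdp_sub. Qed.

HB.instance Definition _ :=
  GRing.isZmodClosed.Build {poly rat} multiples multiples_zmod_closed.

Definition quotient_algebra := Quotient.quot multiples.
HB.instance Definition _ := GRing.Zmodule.on quotient_algebra.

Definition in_quotient (f : {poly rat}) : quotient_algebra :=
  (\pi_(Quotient.quot multiples) f)%qT.

Lemma in_quotient_eq f g : (h %| f - g) = (in_quotient f == in_quotient g).
Proof. exact: (@Quotient.idealrBE _ multiples). Qed.

Definition quo_lift (x : quotient_algebra) : {poly rat} :=
  repr (x : Quotient.quot multiples).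

Lemma quo_liftK x : in_quotient (quo_lift x) = x.
Proof. exact: (@reprK _ (Quotient.quot multiples)). Qed.

Lemma in_quotientD f g : in_quotient (f + g) = in_quotient f + in_quotient g.
Proof. exact: (raddfD (\pi_(Quotient.quot multiples)%qT)). Qed.

Definition quo_one := in_quotient 1.
Definition quo_mul x y := in_quotient (quo_lift x * quo_lift y).

Lemma in_quotientM f g : in_quotient (f * g) = quo_mul (in_quotient f) (in_quotient g).
Proof.
apply/eqP; rewrite -in_quotient_eq.
have rP k : h %| k - quo_lift (in_quotient k) by rewrite in_quotient_eq quo_liftK.
set f' := quo_lift _; set g' := quo_lift _.
have -> : f * g - f' * g' = (f - f') * g + f' * (g - g').
  by rewrite mulrBl mulrBr addrA subrK.
by apply: dvdp_add; [apply: dvdp_mulr | apply: dvdp_mull]; apply: rP.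
Qed.

Lemma quo_mulA : associative quo_mul.
Proof.
move=> x y z; rewrite -(quo_liftK x) -(quo_liftK y) -(quo_liftK z).
by rewrite -!in_quotientM mulrA.
Qed.
Lemma quo_mulC : commutative quo_mul.
Proof. by move=> x y; rewrite /quo_mul mulrC. Qed.
Lemma quo_mul1 : left_id quo_one quo_mul.
Proof. by move=> x; rewrite -(quo_liftK x) -in_quotientM mul1r. Qed.
Lemma quo_mulD : left_distributive quo_mul +%R.
Proof.
move=> x y z; rewrite -(quo_liftK x) -(quo_liftK y) -(quo_liftK z).
by rewrite -in_quotientD -!in_quotientM mulrDl in_quotientD.
Qed.

HB.instance Definition _ :=
  GRing.Zmodule_isComPzRing.Build quotient_algebra quo_mulA quo_mulC quo_mul1 quo_mulD.

End QuotientAlgebra.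

(** * Fractional ideals *)

Definition is_subring (K : comPzRingType) (S : set K) : Prop :=
  [/\ S 1, forall x y, S x -> S y -> S (x - y) &
      forall x y, S x -> S y -> S (x * y)].

(* For h in W(q) the class alpha of x is a unit of K, hence q / alpha is the
   unique b such that alpha * b = q. *)
Definition frobenius_order (q : nat) (h : {poly rat}) : set (quotient_algebra h) :=
  let alpha := in_quotient h 'X in
  smallest (@is_subring (quotient_algebra h)) [set b | b = alpha \/ alpha * b = q%:R]%classic.

Arguments frobenius_order : clear implicits.

(* I (x) Q = K is expressed by: every element of K has a nonzero multiple by an
   integer in I; indeed I has no torsion, so that I (x) Q is the subspace of the
   elements y / n of K, with y in I and n > 0. *)
Definition is_fractional_ideal (h : {poly rat}) (R I : set (quotient_algebra h)) : Prop :=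
  [/\ [/\ I 0, forall x y, I x -> I y -> I (x + y) &
          forall a x, R a -> I x -> I (a * x)],
      exists (n : nat) (g : 'I_n -> quotient_algebra h),
        I = [set x | exists2 a : 'I_n -> quotient_algebra h,
               forall i, R (a i) & x = \sum_(i < n) a i * g i]%classic &
      forall x, exists2 n : nat, (0 < n)%N & I (x *+ n)].

Section FractionalIdealCategory.
Variables (h : {poly rat}) (R : set (quotient_algebra h)).

Record fractional_ideal := FractionalIdeal {
  fi_set :> set (quotient_algebra h);
  fi_setP : is_fractional_ideal R fi_set }.

Implicit Types I J : fractional_ideal.

Record fi_hom I J := FiHom {
  fi_fun :> fi_set I -> fi_set J;
  fi_homP : forall (a : quotient_algebra h) (x y z : fi_set I), R a ->
    val z = a * val x + val y ->
    val (fi_fun z) = a * val (fi_fun x) + val (fi_fun y) }.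

Lemma fi_hom_eq I J (f g : fi_hom I J) : f =1 g -> f = g.
Proof.
case: f g => f fP [g gP] /= /funext fg; subst g.
by rewrite (Prop_irrelevance gP fP).
Qed.

Program Definition fi_id I : fi_hom I I := @FiHom I I id _.
Program Definition fi_comp I1 I2 I3 (g : fi_hom I2 I3) (f : fi_hom I1 I2) :
  fi_hom I1 I3 := @FiHom I1 I3 (g \o f) _.
Next Obligation.
by intros; apply: fi_homP => //; apply: fi_homP.
Qed.

Program Definition fractional_ideal_cat : category :=
  @Category fractional_ideal fi_hom fi_id fi_comp _ _ _.
Next Obligation. by intros; apply: fi_hom_eq. Qed.
Next Obligation. by intros; apply: fi_hom_eq. Qed.
Next Obligation. by intros; apply: fi_hom_eq. Qed.

End FractionalIdealCategory.

(* Main.v *)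
From HB Require Import structures.
From mathcomp Require Import all_boot all_order all_algebra.
From mathcomp Require Import all_field.
From mathcomp Require Import boolp classical_sets.
Require Import Defs.

Set Implicit Arguments.
Unset Strict Implicit.
Unset Printing Implicit Defensive.

Import Order.TTheory GRing.Theory Num.Theory.
Local Open Scope ring_scope.

(** Write alpha for the class of x in K, q for p ^ r and beta for q / alpha.  The
   argument rests on four properties of h: it is monic, it has integer
   coefficients, it is square-free, and each complex root z satisfies z z^* = q.

   From M(h) to ideals.  Let (T, F) be an object of M(h).  As the characteristic
   polynomial h of F is square-free, F (x) Q has a cyclic vector
   ([cyclic_vector_exists]), so T (x) Q is isomorphic to Q[x]/(h) = K with F acting
   as alpha ([cyclic_coordinates]).  This embeds T in K as a full lattice stable
   under alpha, and also under beta, because FV = q and alpha is a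
   non-zero-divisor; hence the image of T is a fractional R-ideal
   ([frob_module_realized]).  Additive maps that commute with F are the same as
   R-linear maps between the images, since R is generated by alpha and beta
   ([induced_hom_exists], [induced_hom_full]); this makes the functor fully
   faithful.

   From ideals to M(h).  The conjugate of a root z of h is the root q / z, so that h
   divides its own reciprocal polynomial x^n h(q / x) ([weil_reciprocal]) and beta
   is a root of h as well.  Both generators of R are thus integral, R is finitely
   generated over Z, and so is every fractional ideal I; by the Smith normal form I
   has a Z-basis with n = deg h elements ([fractional_ideal_lattice]).  The matrix
   of alpha in this basis is integral, is killed only by multiples of h and so has
   characteristic polynomial h ([lattice_char_poly]); being square-free, h makes it
   semisimple ([semisimple_squarefree]).  Therefore I comes from an object of M(h)
   ([fractional_ideal_realized]), and the functor is essentially surjective. *)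

(** * Square-free polynomials *)

(** Principality of ideals of F[x] is stated for predicates in Prop, because it is
   applied to annihilators and to conductors of stable subspaces. *)
Lemma ideal_principal (F : fieldType) (P : {poly F} -> Prop) :
    P 0 -> (forall f g, P f -> P g -> P (f + g)) ->
    (forall f g, P f -> P (g * f)) ->
  exists d, forall f, P f <-> d %| f.
Proof.
move=> P0 PD PM.
have [[f0 Pf0 f0n0]|noP] := pselect (exists2 f, P f & f != 0); last first.
  exists 0 => f; split=> [Pf|/dvd0pP -> //].
  by rewrite dvd0p; apply: contrapT => /negP f0; apply: noP; exists f.
pose small k := `[< exists f, [/\ P f, f != 0 & size f = k] >].
have ex_small : exists k, small k by exists (size f0); apply/asboolP; exists f0.
have [k /asboolP[d [Pd dn0 dk]] kmin] := ex_minnP ex_small.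
exists d => f; split=> [Pf|/dvdpP[g ->]]; last exact: PM.
apply: contrapT => ndf.
have rn0 : f %% d != 0 by apply/negP => /eqP r0; apply: ndf; rewrite /dvdp r0.
have Pr : P (f %% d).
  have -> : f %% d = f + (- (f %/ d)) * d.
    by rewrite {2}(divp_eq f d) mulNr addrAC subrr add0r.
  by apply: PD => //; apply: PM.
have := kmin (size (f %% d)); rewrite leqNgt -dk ltn_modp dn0 => H.
by have := H (asboolT (ex_intro _ _ (And3 Pr rn0 erefl))).
Qed.

Lemma squarefree_neq0 (h : {poly rat}) : square_free h -> h != 0.
Proof.
move=> sq; apply/negP => /eqP h0; have := sq 0.
by rewrite h0 dvdp0 size_poly0 => /(_ isT).
Qed.

Lemma squarefree_coprime (d k : {poly rat}) : square_free (d * k) -> coprimep d k.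
Proof.
move=> sq; rewrite coprimep_def; apply/eqP/sq.
by rewrite expr2 dvdp_mul ?dvdp_gcdl ?dvdp_gcdr.
Qed.

(** Let d = gcd h g and h = d k.  A root of k would be a root of h, hence of g, hence
   a common root of the factors d and k, which are coprime. *)
Lemma squarefree_dvdp_roots (h g : {poly rat}) : square_free h ->
    (forall z : algC, root (map_poly ratr h) z -> root (map_poly ratr g) z) ->
  h %| g.
Proof.
move=> sq hg; pose d := gcdp h g; pose k := h %/ d.
have hkd : h = d * k by rewrite mulrC divpK // dvdp_gcdl.
have h0 := squarefree_neq0 sq.
have [/size_poly1P[c c0 kc]|] := boolP (size k == 1%N).
  have: d %| g by apply: dvdp_gcdr.
  by rewrite hkd kc mulrC mul_polyC dvdpZl.
rewrite -(size_map_poly (ratr : {rmorphism rat -> algC})) => /closed_rootP[z kz].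
have hz : root (map_poly ratr h) z by rewrite hkd rmorphM rootM kz orbT.
have dz : root (map_poly ratr d) z by rewrite gcdp_map root_gcd hz hg.
have: coprimep d k by apply: squarefree_coprime; rewrite -hkd.
rewrite -(coprimep_map (ratr : {rmorphism rat -> algC})).
by move/coprimep_root => /(_ _ dz); rewrite /root in kz *; move/negP.
Qed.

(** * Cyclic vectors for a square-free characteristic polynomial *)

Section CyclicVector.
Variables (n' : nat) (A : 'M[rat]_n'.+1) (h : {poly rat}).
Local Notation n := n'.+1.
Hypotheses (Ah : char_poly A = h) (sq : square_free h).

Lemma horner_mxM f g : horner_mx A (f * g) = horner_mx A f *m horner_mx A g.
Proof. exact: rmorphM. Qed.

(** The minimal and the characteristic polynomial have the same complex roots, so a
   square-free characteristic polynomial is the minimal polynomial. *)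
Lemma horner_mx_eq0_squarefree f : horner_mx A f = 0 <-> h %| f.
Proof.
split=> [fA|/dvdpP[g ->]]; last by rewrite -Ah rmorphM /= Cayley_Hamilton mulr0.
apply: dvdp_trans (mxminpoly_min fA); apply: squarefree_dvdp_roots => // z.
by rewrite -mxminpoly_map root_mxminpoly -map_char_poly Ah.
Qed.

Lemma annihilator_principal (v : 'rV[rat]_n) :
  exists d, forall f, v *m horner_mx A f = 0 <-> d %| f.
Proof.
apply: ideal_principal => [|f g fv gv|f g fv].
- by rewrite rmorph0 mulmx0.
- by rewrite rmorphD /= mulmxDr fv gv addr0.
- by rewrite mulrC horner_mxM mulmxA fv mul0mx.
Qed.

(** If v has annihilator d with h = d k and k not constant, then d(A) is not zero and
   some row w of d(A) is a nonzero vector killed by k.  Its annihilator e divides k,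
   so it is coprime to d, and v + w has annihilator d e. *)
Lemma annihilator_enlarge (v : 'rV[rat]_n) d :
    (forall f, v *m horner_mx A f = 0 <-> d %| f) -> ~~ (h %| d) ->
  exists (w : 'rV[rat]_n) (e : {poly rat}),
    (forall f, w *m horner_mx A f = 0 <-> e %| f) /\ (size d < size e)%N.
Proof.
move=> vd hd.
have [k hk] : exists k, h = d * k.
  have /vd/dvdpP[k ->] : v *m horner_mx A h = 0.
    by rewrite (horner_mx_eq0_squarefree h).2 ?mulmx0.
  by exists k; rewrite mulrC.
have h0 := squarefree_neq0 sq.
have d0 : d != 0 by apply: contraNneq h0 => d0; rewrite hk d0 mul0r.
have [i rowi] : exists i, row i (horner_mx A d) != 0.
  apply: contrapT => allrow; move/negP: hd; apply; apply/horner_mx_eq0_squarefree.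
  apply/row_matrixP => i; rewrite row0; apply: contrapT => /eqP ri.
  by apply: allrow; exists i.
pose w := row i (horner_mx A d).
have [e we] := annihilator_principal w.
have ek : e %| k.
  apply/we; rewrite -row_mul -horner_mxM -hk.
  by rewrite (horner_mx_eq0_squarefree h).2 ?row0.
have e0 : e != 0.
  apply: contraNneq h0 => e0; move: ek; rewrite e0 dvd0p => /eqP k0.
  by rewrite hk k0 mulr0.
have cde : coprimep d e.
  by apply: coprimep_dvdl ek _; apply: squarefree_coprime; rewrite -hk.
exists (v + w), (d * e); split=> [f|]; last first.
  have : e != 0 := e0; rewrite size_mul // -size_poly_gt0.
  case sz: (size e) => [|[|m]] // _; last by rewrite !addnS /= ltnS leq_addr.
  have e1 : w *m horner_mx A 1 = 0.
    by apply/we; rewrite dvdp1 sz.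
  by move: rowi; rewrite -[row i _]mulmx1 -[1%:M](rmorph1 (horner_mx A)) e1 eqxx.
split=> [vwf|]; last first.
  rewrite mulmxDl => def; rewrite (vd f).2 ?(we f).2 ?addr0 //.
    by apply: dvdp_trans def; apply: dvdp_mull.
  by apply: dvdp_trans def; apply: dvdp_mulr.
have vwfg g : (v + w) *m horner_mx A (f * g) = 0.
  by rewrite horner_mxM mulmxA vwf mul0mx.
rewrite Gauss_dvdp //; apply/andP; split.
  have : d %| f * e.
    apply/vd; have := vwfg e; rewrite mulmxDl.
    by rewrite (we (f * e)).2 ?addr0 ?dvdp_mull.
  by rewrite Gauss_dvdpl.
have : e %| f * d.
  apply/we; have := vwfg d; rewrite mulmxDl.
  by rewrite (vd (f * d)).2 ?add0r ?dvdp_mull.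
by rewrite Gauss_dvdpl // coprimep_sym.
Qed.

(** Annihilators divide h, so enlarging them must stop, and it stops only at h. *)
Lemma cyclic_vector_exists :
  exists v : 'rV[rat]_n, forall f, v *m horner_mx A f = 0 <-> h %| f.
Proof.
have main k (v : 'rV[rat]_n) d : (forall f, v *m horner_mx A f = 0 <-> d %| f) ->
    (size h <= size d + k)%N ->
  exists v : 'rV[rat]_n, forall f, v *m horner_mx A f = 0 <-> h %| f.
  elim: k v d => [|k IHk] v d vd hdk.
    have dh : d %| h by apply/vd; rewrite (horner_mx_eq0_squarefree h).2 ?mulmx0.
    have dhE : d %= h.
      rewrite -dvdp_size_eqp // eqn_leq dvdp_leq ?squarefree_neq0 //=.
      by rewrite addn0 in hdk.
    by exists v => f; rewrite vd (eqp_dvdl f dhE).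
  have [hd|hd] := boolP (h %| d).
    have dhE : d %= h.
      rewrite /eqp hd andbT; apply/vd.
      by rewrite (horner_mx_eq0_squarefree h).2 ?mulmx0.
    by exists v => f; rewrite vd (eqp_dvdl f dhE).
  have [w [e [we de]]] := annihilator_enlarge vd hd.
  by apply: (IHk w e) => //; apply: leq_trans hdk _; rewrite addnS -addSn leq_add2r.
have [d d0] := annihilator_principal 0.
by apply: (main (size h) 0 d) => //; apply: leq_addl.
Qed.

(** The vectors v A^i with i < n are independent, since a relation between them would
   be a nonzero polynomial of degree < n that kills v. *)
Lemma krylov_basis (v : 'rV[rat]_n) :
    (forall f, v *m horner_mx A f = 0 <-> h %| f) ->
  exists2 P : 'M[rat]_n, P \in unitmx &
    forall w, w *m P = v *m horner_mx A (rVpoly w).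
Proof.
move=> vh; pose P : 'M[rat]_n := \matrix_(i < n) (v *m horner_mx A 'X^i).
have PE w : w *m P = v *m horner_mx A (rVpoly w).
  rewrite mulmx_sum_row [rVpoly w]poly_def rmorph_sum mulmx_sumr.
  by apply: eq_bigr => i _; rewrite rowK /= valK horner_mxZ -scalemxAr.
exists P => //; rewrite -row_free_unit -kermx_eq0; apply/eqP/row_matrixP => i.
set w := row i _; rewrite row0.
have : w *m P = 0 by rewrite /w -row_mul mulmx_ker row0.
rewrite PE => /vh hw.
have r0 : rVpoly w = 0.
  apply/eqP; apply: contraTT hw => w0; apply: contra w0 => /dvdp_leq.
  case: eqP => // _ /(_ isT).
  by rewrite -Ah size_char_poly leqNgt ltnS size_poly.
by rewrite -[w]rVpolyK r0 raddf0.
Qed.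

Lemma cyclic_vector_generates (v u : 'rV[rat]_n) :
  (forall f, v *m horner_mx A f = 0 <-> h %| f) ->
  exists f, u = v *m horner_mx A f.
Proof.
case/krylov_basis=> P Pu PE.
by exists (rVpoly (u *m invmx P)); rewrite -PE mulmxKV.
Qed.

(** With a cyclic vector v, a stable subspace U is the image of d(A), where d generates
   the ideal of the f such that v f(A) lies in U.  If h = d k, then d and k are
   coprime, and a Bezout relation shows that the image of k(A) is a complement. *)
Lemma semisimple_squarefree : semisimple_mx A.
Proof.
have [v vh] := cyclic_vector_exists.
move=> U Ust.
have [d Ud] : exists d, forall f, (v *m horner_mx A f <= U)%MS <-> d %| f.
  apply: (@ideal_principal _ (fun f => (v *m horner_mx A f <= U)%MS)) => [|f g|f g].
  - by rewrite rmorph0 mulmx0 sub0mx.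
  - by move=> fU gU; rewrite rmorphD /= mulmxDr addmx_sub.
  - move=> fU; rewrite mulrC horner_mxM mulmxA.
    by apply: submx_trans (submxMr _ fU) _; apply: horner_mx_stable.
have [k hk] : exists k, h = d * k.
  have /Ud/dvdpP[k ->] : (v *m horner_mx A h <= U)%MS.
    by rewrite (vh h).2 ?sub0mx.
  by exists k; rewrite mulrC.
have [[a b] /= ab1] : exists ab, ab.1 * d + ab.2 * k = 1.
  have /Bezout_eq1_coprimepP[ab] : coprimep d k.
    by apply: squarefree_coprime; rewrite -hk.
  by exists ab.
have UE : (U :=: horner_mx A d)%MS.
  apply/eqmxP/andP; split; apply/row_subP => i.
    have [f rf] := cyclic_vector_generates (row i U) vh.
    have /Ud/dvdpP[g fg] : (v *m horner_mx A f <= U)%MS by rewrite -rf row_sub.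
    by rewrite rf fg horner_mxM mulmxA submxMl.
  have [f rf] := cyclic_vector_generates (row i 1%:M) vh.
  rewrite -[horner_mx A d]mul1mx row_mul rf -mulmxA -horner_mxM.
  by apply/Ud/dvdp_mull.
exists (horner_mx A k); split.
- rewrite -{2}(horner_mx_X A) -horner_mxM mulrC horner_mxM.
  exact: submxMl.
- apply/eqmxP/andP; split; first exact: submx1.
  have -> : 1%:M = horner_mx A a *m horner_mx A d + horner_mx A b *m horner_mx A k.
    rewrite -!horner_mxM.
    by rewrite [LHS](esym (rmorph1 (horner_mx A))) -ab1 rmorphD.
  by apply: addmx_sub_adds; rewrite ?UE submxMl.
- apply/eqP; rewrite -submx0; apply/row_subP => i.
  set x := row i _.
  have /submxP[y xy] : (x <= horner_mx A d)%MS.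
    by rewrite -UE; apply: submx_trans (row_sub _ _) (capmxSl _ _).
  have /submxP[z xz] : (x <= horner_mx A k)%MS.
    by apply: submx_trans (row_sub _ _) (capmxSr _ _).
  have hA : horner_mx A h = 0 by apply/horner_mx_eq0_squarefree.
  suff -> : x = 0 by rewrite sub0mx.
  rewrite -[x]mulmx1 -[1%:M](rmorph1 (horner_mx A)) -ab1 rmorphD mulmxDr /=.
  rewrite {1}xz xy -!mulmxA -!horner_mxM.
  have -> : k * (a * d) = a * h by rewrite hk mulrCA [k * d]mulrC.
  have -> : d * (b * k) = b * h by rewrite hk mulrCA.
  by rewrite !horner_mxM hA !mulmx0 addr0.
Qed.

End CyclicVector.

(** * The quotient algebra and the elements alpha and q / alpha *)

Lemma weil_frobenius (p : nat) (p_pr : prime p) (r : nat) (h : {poly rat}) :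
  weil p_pr r h ->
  [/\ h \is monic, exists H : {poly int}, h = map_poly intr H &
      forall z : algC, root (map_poly ratr h) z -> z * z^* = (p ^ r)%:R].
Proof.
case=> s sW ->; split.
- rewrite big_seq; apply: (big_ind (fun g => g \is monic)) => [|f g|f fs].
  + exact: monic1.
  + by move=> fm gm; rewrite monicMl.
  + by have [[]] := sW f fs.
- rewrite big_seq.
  apply: (big_ind (fun g => exists H : {poly int}, g = map_poly intr H)).
  + by exists 1; rewrite rmorph1.
  + by move=> _ _ [F ->] [G ->]; exists (F * G); rewrite rmorphM.
  + by move=> f fs; have [[_ _ /floorpP[F ->]] _ _] := sW f fs; exists F.
- move=> z; elim: s sW => [|g s IHs] sW.
    by rewrite big_nil rmorph1 (negbTE (root1 _)).
  rewrite big_cons rmorphM rootM => /orP[gz|]; last first.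
    by apply: IHs => f fs; apply: sW; rewrite inE fs orbT.
  have [_ /(_ z gz) zq _] := sW g (mem_head _ _).
  by rewrite -normCK zq sqrtCK.
Qed.

HB.instance Definition _ (h : {poly rat}) :=
  GRing.isZmodMorphism.Build {poly rat} (quotient_algebra h) (in_quotient h)
    (raddfB (\pi_(Quotient.quot (multiples h))%qT)).
HB.instance Definition _ (h : {poly rat}) :=
  GRing.isMonoidMorphism.Build {poly rat} (quotient_algebra h) (in_quotient h)
    (erefl, @in_quotientM h).

Section FrobeniusElement.
Variables (q : nat) (h : {poly rat}).
Local Notation K := (quotient_algebra h).
Local Notation alpha := (in_quotient h 'X).

Lemma in_quotient_eq0 f : in_quotient h f = 0 <-> h %| f.
Proof.
rewrite -[f in _ %| f]subr0 in_quotient_eq rmorph0.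
by split=> [->|/eqP].
Qed.

Lemma in_quotientE f :
  in_quotient h f = \sum_(i < size f) in_quotient h (f`_i)%:P * alpha ^+ i.
Proof.
rewrite -{1}[f]coefK poly_def rmorph_sum; apply: eq_bigr => i _.
by rewrite -mul_polyC rmorphM rmorphXn.
Qed.

Hypotheses (q_gt0 : (0 < q)%N) (sq : square_free h).
Hypothesis h_roots :
  forall z : algC, root (map_poly ratr h) z -> z * z^* = q%:R.

(** A root 0 of h would give q = 0 * 0^*. *)
Lemma weil_coprime_X : coprimep h 'X.
Proof.
rewrite coprimepX -(fmorph_root (ratr : {rmorphism rat -> algC})) rmorph0.
apply/negP => /h_roots/esym/eqP; rewrite mul0r pnatr_eq0.
by case: (q) q_gt0.
Qed.

Lemma verschiebung_exists : exists beta : K, alpha * beta = q%:R.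
Proof.
have /Bezout_eq1_coprimepP[[u v] /= uv] := weil_coprime_X.
exists (in_quotient h (v * q%:R)).
rewrite -rmorphM -(rmorph_nat (in_quotient h)) /=; apply/eqP.
rewrite -in_quotient_eq -[X in _ - X]mul1r -uv mulrA ['X * v]mulrC mulrDl opprD.
by rewrite addrCA subrr addr0 -!mulNr dvdp_mulr // dvdp_mull.
Qed.

Lemma alpha_cancel (x : K) : alpha * x = 0 -> x = 0.
Proof.
rewrite -(quo_liftK x) -rmorphM /= => /in_quotient_eq0 hx; apply/in_quotient_eq0.
by rewrite Gauss_dvdpr ?weil_coprime_X in hx.
Qed.

Lemma alpha_inj (x y : K) : alpha * x = alpha * y -> x = y.
Proof.
move=> /eqP; rewrite -subr_eq0 -mulrBr => /eqP/alpha_cancel/eqP.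
by rewrite subr_eq0 => /eqP.
Qed.

(** The polynomial is x^n h(q / x).  It vanishes at each root z of h because
   q / z = z^* is a root of h, h having real coefficients. *)
Lemma weil_reciprocal :
  h %| \sum_(i < size h) (h`_i * q%:R ^+ i) *: 'X^((size h).-1 - i).
Proof.
apply: squarefree_dvdp_roots => // z hz.
have hzc : root (map_poly ratr h) z^*.
  rewrite /root -[map_poly _ h](_ : map_poly Num.conj (map_poly ratr h) = _).
    by rewrite horner_map (eqP hz) rmorph0.
  apply/polyP => i; rewrite !coef_map /=; exact: fmorph_rat.
have zq := h_roots hz.
rewrite /root rmorph_sum /= horner_sum.
apply/eqP; transitivity (z ^+ (size h).-1 * (map_poly ratr h).[z^*]); last first.
  by rewrite (eqP hzc) mulr0.
rewrite horner_coef size_map_poly mulr_sumr; apply: eq_bigr => i _.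
have le_i : (i <= (size h).-1)%N by rewrite -ltnS (ltn_predK (ltn_ord i)).
rewrite map_polyZ /= map_polyXn hornerZ hornerXn coef_map /=.
rewrite rmorphM rmorphXn /= rmorph_nat.
rewrite -zq exprMn -[in RHS](subnK le_i) exprD.
by rewrite mulrAC [RHS]mulrACA [_ * z ^+ (_ - _)]mulrC.
Qed.

(** Evaluating [weil_reciprocal] at alpha gives alpha^n h(beta) = 0, and alpha is a
   non-zero-divisor. *)
Lemma verschiebung_root (beta : K) : alpha * beta = q%:R ->
  \sum_(i < size h) in_quotient h (h`_i)%:P * beta ^+ i = 0.
Proof.
move=> ab; have alphaX_cancel k (x : K) : alpha ^+ k * x = 0 -> x = 0.
  elim: k => [|k IHk]; first by rewrite mul1r.
  by rewrite exprS -mulrA => /alpha_cancel/IHk.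
apply: (@alphaX_cancel (size h).-1).
have /in_quotient_eq0 reciprocal0 := weil_reciprocal.
apply: etrans reciprocal0.
rewrite mulr_sumr [RHS]raddf_sum; apply: eq_bigr => i _.
have le_i : (i <= (size h).-1)%N by rewrite -ltnS (ltn_predK (ltn_ord i)).
rewrite -mul_polyC polyCM /= !rmorphM polyC_exp !rmorphXn /= polyC_natr rmorph_nat.
rewrite -ab exprMn -[in LHS](subnK le_i) exprD.
by rewrite [RHS]mulrAC [LHS]mulrACA [_ * alpha ^+ (_ - _)]mulrC.
Qed.

End FrobeniusElement.

(** * Lattices in the quotient algebra *)

Lemma clear_denominators m n (M : 'M[rat]_(m, n)) :
  exists2 k : nat, (0 < k)%N & exists G : 'M[int]_(m, n), M *+ k = map_mx intr G.
Proof.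
pose D : int := \prod_i \prod_j denq (M i j).
have D0 : 0 < D by apply: prodr_gt0 => i _; apply: prodr_gt0 => j _; apply: denq_gt0.
have DE i j : exists z : int, M i j * D%:~R = z%:~R.
  exists (numq (M i j) * ((\prod_(j' | j' != j) denq (M i j')) *
          \prod_(i' | i' != i) \prod_j' denq (M i' j'))).
  rewrite /D (bigD1 i) //= (bigD1 j) //= -mulrA !rmorphM /=.
  by rewrite !mulrA -numqE.
have [G GE] := choice (fun ij => DE ij.1 ij.2).
exists `|D|%N; first by rewrite absz_gt0 gt_eqF.
exists (\matrix_(i, j) G (i, j)); apply/matrixP => i j.
by rewrite mulmxnE !mxE -(GE (i, j)) -mulr_natr natr_absz gtr0_norm.
Qed.

(** The rows of M and the rows of C span the same lattice.  If L D R is the Smith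
   normal form of a multiple k M, then C consists of the first n rows of k^-1 D R; the
   other rows of D vanish. *)
Lemma int_lattice_basis N n (M : 'M[rat]_(N, n)) : row_full M ->
  exists2 C : 'M[rat]_n, C \in unitmx &
    exists (X : 'M[int]_(N, n)) (Y : 'M[int]_(n, N)),
      M = map_mx intr X *m C /\ C = map_mx intr Y *m M.
Proof.
move=> Mfull; have [k k_gt0 [G MG]] := clear_denominators M.
have [L Lu [R Ru [d _ GE]]] := int_Smith_normal_form G.
have le_nN : (n <= N)%N by rewrite -(eqP Mfull) rank_leq_row.
(* D is the square part of the rectangular diagonal matrix D'. *)
pose D : 'M[int]_n := \matrix_(i, j) (d`_i *+ (i == j :> nat)).
pose D' : 'M[int]_(N, n) := \matrix_(i, j) (d`_i *+ (i == j :> nat)).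
have DE : D' = pid_mx n *m D.
  apply/matrixP => i j; rewrite !mxE.
  under eq_bigr => l _ do rewrite !mxE.
  have [lt_i|ge_i] := ltnP i n.
    rewrite (bigD1 (Ordinal lt_i)) //= eqxx mul1r big1 ?addr0 // => l.
    by rewrite -val_eqE /= eq_sym => /negbTE ->; rewrite mul0r.
  rewrite big1 => [|l _]; first by rewrite gtn_eqF ?mulr0n // (leq_trans (ltn_ord j)).
  by rewrite andbF mul0r.
have DE' : D = pid_mx n *m D'.
  by rewrite DE mulmxA pid_mx_id // pid_mx_1 mul1mx.
have k0 : (k%:R : rat) != 0 by rewrite pnatr_eq0 -lt0n.
pose C : 'M[rat]_n := k%:R^-1 *: map_mx intr (D *m R).
pose X : 'M[int]_(N, n) := L *m pid_mx n.
pose Y : 'M[int]_(n, N) := pid_mx n *m invmx L.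
have ME : M = k%:R^-1 *: map_mx intr G by rewrite -MG -scaler_nat scalerK.
have MX : M = map_mx intr X *m C.
  by rewrite -scalemxAr -map_mxM ME GE -/D' DE !mulmxA.
exists C; last first.
  exists X, Y; split=> //.
  by rewrite ME -scalemxAr -map_mxM GE -/D' /Y !mulmxA mulmxKV // -DE'.
rewrite -row_full_unit -sub1mx; apply: submx_trans (_ : (M <= C)%MS).
  by rewrite sub1mx.
by rewrite MX submxMl.
Qed.

Section Coordinates.
Variables (h : {poly rat}) (n : nat).
Local Notation K := (quotient_algebra h).

Definition of_coords (v : 'rV[rat]_n) : K := in_quotient h (rVpoly v).

Lemma of_coords_zmod_morphism : zmod_morphism of_coords.
Proof. by move=> v w; rewrite /of_coords !raddfB. Qed.
HB.instance Definition _ :=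
  GRing.isZmodMorphism.Build _ _ of_coords of_coords_zmod_morphism.

Lemma of_coordsZ c v : of_coords (c *: v) = in_quotient h c%:P * of_coords v.
Proof. by rewrite /of_coords linearZ -rmorphM /= mul_polyC. Qed.

Hypotheses (h_size : size h = n.+1).

Lemma of_coords_inj : injective of_coords.
Proof.
apply: raddf_inj => v /in_quotient_eq0 hv; rewrite -[v]rVpolyK.
suff -> : rVpoly v = 0 by rewrite raddf0.
apply/eqP; apply: contraTT hv => v0; apply: contra v0 => /dvdp_leq.
case: eqP => // _ /(_ isT).
by rewrite h_size leqNgt ltnS size_poly.
Qed.

Lemma of_coords_surj x : exists v, of_coords v = x.
Proof.
exists (poly_rV (quo_lift x %% h)); rewrite -[RHS]quo_liftK /of_coords poly_rV_K.
  apply/eqP; rewrite -in_quotient_eq {2}(divp_eq (quo_lift x) h).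
  by rewrite opprD addrCA subrr addr0 -mulNr dvdp_mull.
have h0 : h != 0 by rewrite -size_poly_eq0 h_size.
by rewrite -ltnS -h_size ltn_modp.
Qed.

End Coordinates.

Section Lattice.
Variables (h : {poly rat}) (n : nat) (C : 'M[rat]_n).
Local Notation K := (quotient_algebra h).
Local Notation alpha := (in_quotient h 'X).

(** The rows of C are the coordinates, in the basis 1, x, ..., x^(n-1) of K, of the
   basis vectors of a lattice, and lattice_map sends integer coordinates in that
   lattice to K.  Full lattices in K are the images of these maps for invertible C. *)
Definition lattice_map (v : 'rV[int]_n) : K := of_coords h (map_mx intr v *m C).

Lemma lattice_map_zmod_morphism : zmod_morphism lattice_map.
Proof. by move=> v w; rewrite /lattice_map map_mxB mulmxBl raddfB. Qed.
HB.instance Definition _ :=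
  GRing.isZmodMorphism.Build _ _ lattice_map lattice_map_zmod_morphism.

Lemma lattice_map_sum v :
  lattice_map v = \sum_i (v 0 i)%:~R * lattice_map (delta_mx 0 i).
Proof.
rewrite {1}(row_sum_delta v) raddf_sum; apply: eq_bigr => i _ /=.
by rewrite -{1}[v 0 i]intz scaler_int raddfMz mulrzl.
Qed.

Hypotheses (h_size : size h = n.+1) (Cu : C \in unitmx).

Lemma lattice_map_inj : injective lattice_map.
Proof.
apply: raddf_inj => v; rewrite -(raddf0 (of_coords h (n := n))).
move/(of_coords_inj h_size)/(congr1 (mulmx^~ (invmx C))).
rewrite mulmxK // mul0mx => /matrixP v0; apply/matrixP => i j.
by have /eqP := v0 i j; rewrite !mxE intr_eq0 => /eqP.
Qed.

Lemma lattice_map_full x :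
  exists2 k : nat, (0 < k)%N & exists v, x *+ k = lattice_map v.
Proof.
have [w <-] := of_coords_surj h_size x.
have [k k0 [v kv]] := clear_denominators (w *m invmx C).
exists k => //; exists v; rewrite /lattice_map -kv -scaler_nat -scalemxAl.
by rewrite mulmxKV // scaler_nat raddfMn.
Qed.

Lemma lattice_mul_matrix (a : K) :
    (forall v, exists w, a * lattice_map v = lattice_map w) ->
  exists A : 'M[int]_n, forall v, a * lattice_map v = lattice_map (v *m A).
Proof.
move=> aL; have [A AE] := choice (fun i => aL (delta_mx 0 i)).
exists (\matrix_i A i) => v; rewrite lattice_map_sum mulr_sumr.
rewrite mulmx_sum_row raddf_sum; apply: eq_bigr => i _ /=.
by rewrite mulrCA AE rowK -{2}[v 0 i]intz scaler_int raddfMz mulrzl.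
Qed.

(** If f kills the matrix of alpha, then f(alpha) kills a lattice that spans K, hence
   kills 1, and h divides f.  By Cayley-Hamilton this applies to the characteristic
   polynomial, which is monic of the same degree as h. *)
Lemma lattice_char_poly (A : 'M[int]_n) : h \is monic ->
  (forall v, alpha * lattice_map v = lattice_map (v *m A)) ->
  char_poly (map_mx intr A) = h.
Proof.
set A' := map_mx intr A => h_monic AE.
have AE' w : alpha * of_coords h (w *m C) = of_coords h (w *m A' *m C).
  rewrite (row_sum_delta w) !mulmx_suml !raddf_sum mulr_sumr; apply: eq_bigr => i _.
  rewrite /= -!scalemxAl.
  rewrite !of_coordsZ mulrCA; congr (_ * _).
  have := AE (delta_mx 0 i).
  by rewrite /lattice_map map_mxM map_delta_mx.
apply/eqP; rewrite -eqp_monic ?char_poly_monic // eqp_sym -dvdp_size_eqp.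
  by rewrite h_size size_char_poly.
move: (n) h_size C Cu A' AE' => [|n'] h_size' C' Cu' A' AE'.
  move/eqP/size_poly1P: h_size' => [c c0 ->].
  by rewrite -[c%:P]mulr1 mul_polyC dvdpZl // dvd1p.
have fE f w :
    in_quotient h f * of_coords h (w *m C') = of_coords h (w *m horner_mx A' f *m C').
  elim/poly_ind: f w => [|f c IHf] w.
    by rewrite !rmorph0 mul0r mulmx0 mul0mx raddf0.
  rewrite !rmorphD !rmorphM /= horner_mx_X horner_mx_C mulrDl mulmxDr mulmxDl raddfD.
  rewrite mul_mx_scalar -scalemxAl /= of_coordsZ; congr (_ + _).
  by rewrite mulrAC IHf mulrC AE' -[_ * A']/(_ *m A') mulmxA.
(* w has coordinates of 1 : K, so fE evaluates f(alpha) itself. *)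
have [w w1] := of_coords_surj h_size' 1.
apply/in_quotient_eq0; rewrite -[LHS]mulr1 -w1 -(mulmxKV Cu' w) fE Cayley_Hamilton.
by rewrite mulmx0 mul0mx raddf0.
Qed.

End Lattice.

(** * The order R and its fractional ideals *)

Section IntegerSpan.
Variables (K : comPzRingType).

Definition int_span (J : finType) (e : J -> K) (x : K) : Prop :=
  exists c : J -> int, x = \sum_j e j *~ c j.

Variables (J : finType) (e : J -> K).

Lemma int_span0 : int_span e 0.
Proof. by exists (fun=> 0); rewrite big1. Qed.

Lemma int_spanB x y : int_span e x -> int_span e y -> int_span e (x - y).
Proof.
move=> [c ->] [d ->]; exists (fun j => c j - d j).
by rewrite -sumrB; apply: eq_bigr => j _; rewrite mulrzBr.
Qed.

Lemma int_spanD x y : int_span e x -> int_span e y -> int_span e (x + y).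
Proof.
move=> xS yS; rewrite -[y]opprK; apply: int_spanB => //.
by rewrite -[- y]sub0r; apply: int_spanB => //; apply: int_span0.
Qed.

Lemma int_span_mulz x k : int_span e x -> int_span e (x *~ k).
Proof.
move=> [c ->]; exists (fun j => c j * k); rewrite mulrz_suml.
by apply: eq_bigr => j _; rewrite mulrzA.
Qed.

Lemma int_span_sum (I : finType) (F : I -> K) :
  (forall i, int_span e (F i)) -> int_span e (\sum_i F i).
Proof.
by move=> FS; apply: (big_ind (int_span e)) => //; [apply: int_span0|apply: int_spanD].
Qed.

Lemma int_span_mem j : int_span e (e j).
Proof.
exists (fun i => (i == j)%:R); rewrite (bigD1 j) //= eqxx mulr1z big1 ?addr0 // => i.
by move/negbTE ->; rewrite mulr0z.
Qed.

Lemma int_span_mul a : (forall j, int_span e (a * e j)) ->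
  forall x, int_span e x -> int_span e (a * x).
Proof.
move=> aS x [c ->]; rewrite mulr_sumr; apply: int_span_sum => j.
by rewrite mulrzAr; apply: int_span_mulz.
Qed.

Lemma int_span_sub (P : K -> Prop) : P 0 -> (forall x y, P x -> P y -> P (x - y)) ->
  (forall j, P (e j)) -> forall x, int_span e x -> P x.
Proof.
move=> P0 PB Pe; have PN x : P x -> P (- x) by rewrite -sub0r; apply: PB.
have PD x y : P x -> P y -> P (x + y).
  by move=> Px Py; rewrite -[y]opprK; apply/PB/PN.
have Pn x k : P x -> P (x *+ k).
  by move=> Px; elim: k => [//|k IHk]; rewrite mulrS; apply: PD.
move=> _ [c ->]; apply: (big_ind P) => // j _.
by case: (c j) => k; [apply: Pn|apply/PN/Pn].
Qed.

End IntegerSpan.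

(** An equation h(b) = 0 is turned into an expression of b^n by lower powers, which is
   the form of integrality used to bound the exponents in a set of generators. *)
Lemma monic_relation (h : {poly rat}) (H : {poly int}) (n : nat)
    (b : quotient_algebra h) :
    h \is monic -> h = map_poly intr H -> size h = n.+1 ->
    \sum_(i < size h) in_quotient h (h`_i)%:P * b ^+ i = 0 ->
  exists c : 'I_n -> int, b ^+ n = \sum_(i < n) b ^+ i *~ c i.
Proof.
move=> h_monic hH h_size; rewrite h_size big_ord_recr /=.
have -> : h`_n = 1 by move/monicP: h_monic; rewrite /lead_coef h_size.
rewrite rmorph1 mul1r addrC => /eqP; rewrite addr_eq0 => /eqP ->.
exists (fun i : 'I_n => - H`_i); rewrite -sumrN; apply: eq_bigr => i _.
have -> : h`_i = (H`_i)%:~R by rewrite hH coef_map.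
by rewrite !rmorph_int mulrNz mulrzl.
Qed.

Section FrobeniusOrder.
Variables (q : nat) (h : {poly rat}).
Local Notation K := (quotient_algebra h).
Local Notation alpha := (in_quotient h 'X).
Local Notation R := (frobenius_order q h).

Lemma frobenius_order_subring : is_subring R.
Proof.
split=> [S [[S1 _ _] _] //|x y xR yR S SP|x y xR yR S SP].
  by have [[_ SB _] _] := SP; apply: SB; [apply: xR|apply: yR].
by have [[_ _ SM] _] := SP; apply: SM; [apply: xR|apply: yR].
Qed.

Lemma frobenius_order_alpha : R alpha.
Proof. by move=> S [_]; apply; left. Qed.

Lemma frobenius_order_beta b : alpha * b = q%:R -> R b.
Proof. by move=> ab S [_]; apply; right. Qed.

Lemma frobenius_order_ind (P : K -> Prop) :
    P 1 -> (forall x y, P x -> P y -> P (x - y)) ->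
    (forall x y, P x -> P y -> P (x * y)) ->
    P alpha -> (forall b, alpha * b = q%:R -> P b) ->
  forall a, R a -> P a.
Proof.
move=> P1 PB PM Pa Pb a; apply; split=> // b [->//|]; exact: Pb.
Qed.

Lemma frobenius_order0 : R 0.
Proof. by have [R1 RB _] := frobenius_order_subring; rewrite -(subrr 1); apply: RB. Qed.

Lemma frobenius_order_int k : R k%:~R.
Proof.
have [R1 RB _] := frobenius_order_subring.
apply: (@int_span_sub _ unit (fun=> 1)) => //; first exact: frobenius_order0.
by exists (fun=> k); rewrite big_const card_unit /= addr0.
Qed.

Lemma frobenius_orderX a k : R a -> R (a ^+ k).
Proof.
have [R1 _ RM] := frobenius_order_subring.
by move=> Ra; elim: k => [//|k IHk]; rewrite exprS; apply: RM.
Qed.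

(** The elements of K that map I into itself form a subring, so it is enough to test
   the generators of R. *)
Lemma stable_frobenius_order (I : K -> Prop) :
    I 0 -> (forall x y, I x -> I y -> I (x - y)) ->
    (forall x, I x -> I (alpha * x)) ->
    (forall b, alpha * b = q%:R -> forall x, I x -> I (b * x)) ->
  forall a, R a -> forall x, I x -> I (a * x).
Proof.
move=> I0 IB Ia Ib a Ra.
elim/frobenius_order_ind: a / Ra => //.
- by move=> x; rewrite mul1r.
- by move=> a b Pa Pb x Ix; rewrite mulrBl; apply: IB; [apply: Pa|apply: Pb].
- by move=> a b Pa Pb x Ix; rewrite -mulrA; apply/Pa/Pb.
Qed.

Variables (H : {poly int}) (n : nat).
Hypotheses (q_gt0 : (0 < q)%N) (h_monic : h \is monic) (sq : square_free h).
Hypotheses (hH : h = map_poly intr H) (h_size : size h = n.+1).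
Hypothesis h_roots :
  forall z : algC, root (map_poly ratr h) z -> z * z^* = q%:R.

(** If the g_l generate I over R, then the alpha^i beta^j g_l with i, j <= n generate
   I over Z: by integrality their span is stable under alpha and beta.  Exponents up to
   n, rather than n - 1, keep the g_l themselves in the family when n = 0. *)
Lemma fractional_ideal_int_span (I : set K) : is_fractional_ideal R I ->
  exists (J : finType) (e : J -> K), forall x, I x <-> int_span e x.
Proof.
move=> [[I0 ID IR] [m [g IE]] _].
have [R1 RB RM] := frobenius_order_subring.
have [beta ab] := verschiebung_exists q_gt0 h_roots.
have betaE b : alpha * b = q%:R -> b = beta.
  by move=> ab'; apply: (alpha_inj q_gt0 h_roots); rewrite ab' ab.
have [ca alphaE] : exists c : 'I_n -> int, alpha ^+ n = \sum_(i < n) alpha ^+ i *~ c i.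
  apply: (monic_relation h_monic hH h_size).
  by rewrite -in_quotientE; apply/in_quotient_eq0.
have [cb bE] : exists c : 'I_n -> int, beta ^+ n = \sum_(i < n) beta ^+ i *~ c i.
  apply: (monic_relation h_monic hH h_size).
  exact: (verschiebung_root q_gt0 sq h_roots).
pose J := ('I_n.+1 * 'I_n.+1 * 'I_m)%type.
pose e (j : J) := alpha ^+ j.1.1 * beta ^+ j.1.2 * g j.2.
exists J, e => x; split=> [|xe].
  rewrite {1}IE => -[a Ra ->]; apply: int_span_sum => k.
  apply: (stable_frobenius_order _ _ _ _ (Ra k)).
  - exact: int_span0.
  - exact: int_spanB.
  - apply: int_span_mul => -[[i j] l]; rewrite /e /=.
    have [lt_i|ge_i] := ltnP i n.
      rewrite !mulrA -exprS.
      exact: (@int_span_mem _ _ e (Ordinal (lt_i : i.+1 < n.+1)%N, j, l)).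
    have -> : (i : nat) = n by apply/eqP; rewrite eqn_leq ge_i -ltnS ltn_ord.
    rewrite alphaE !mulr_suml mulr_sumr; apply: int_span_sum => i'.
    rewrite !mulrzAl mulrzAr; apply: int_span_mulz; rewrite !mulrA -exprS.
    exact: (@int_span_mem _ _ e (lift ord0 i', j, l)).
  - move=> b /betaE ->; apply: int_span_mul => -[[i j] l]; rewrite /e /=.
    rewrite !mulrA [beta * _]mulrC -[_ * beta * _]mulrA.
    have [lt_j|ge_j] := ltnP j n.
      rewrite -exprS.
      exact: (@int_span_mem _ _ e (i, Ordinal (lt_j : j.+1 < n.+1)%N, l)).
    have -> : (j : nat) = n by apply/eqP; rewrite eqn_leq ge_j -ltnS ltn_ord.
    rewrite bE !mulr_sumr mulr_suml; apply: int_span_sum => j'.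
    rewrite !mulrzAr mulrzAl; apply: int_span_mulz; rewrite -exprS.
    exact: (@int_span_mem _ _ e (i, lift ord0 j', l)).
  - have := @int_span_mem _ _ e (ord0, ord0, k).
    by rewrite /e /= !expr0 !mul1r.
have IN y : I y -> I (- y).
  move=> Iy; rewrite -mulN1r; apply: IR => //; rewrite -sub0r.
  by apply: RB => //; apply: frobenius_order0.
apply: int_span_sub xe => // [y z Iy Iz|[[i j] l]]; first by apply/ID/IN.
rewrite /e /=; apply: IR.
  apply: RM; apply: frobenius_orderX; first exact: frobenius_order_alpha.
  exact: frobenius_order_beta.
rewrite IE; exists (fun k => (k == l)%:R) => [k|].
  exact: (frobenius_order_int (k == l)).
by rewrite (bigD1 l) //= eqxx mul1r big1 ?addr0 // => k /negbTE ->; rewrite mul0r.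
Qed.

Lemma fractional_ideal_lattice (I : set K) : is_fractional_ideal R I ->
  exists2 C : 'M[rat]_n, C \in unitmx &
    forall x, I x <-> exists v, x = lattice_map h C v.
Proof.
move=> Iideal; have [_ _ Ifull] := Iideal.
have [J [e Ie]] := fractional_ideal_int_span Iideal.
have [w we] := choice (fun j => of_coords_surj h_size (e j)).
pose M : 'M[rat]_(#|J|, n) := \matrix_i w (enum_val i).
have spanE (c : 'rV[int]_#|J|) :
    of_coords h (map_mx intr c *m M) = \sum_j e j *~ c 0 (enum_rank j).
  rewrite mulmx_sum_row raddf_sum (reindex_onto _ _ (fun j _ => enum_valK j)) /=.
  apply: eq_big => [i|i _]; first by rewrite enum_rankK eqxx.
  by rewrite rowK mxE scaler_int raddfMz /= enum_rankK we.
have IM x : I x <-> exists c : 'rV[int]_#|J|, x = of_coords h (map_mx intr c *m M).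
  rewrite Ie; split=> [[c ->]|[c ->]]; last by exists (fun j => c 0 (enum_rank j)).
  exists (\row_i c (enum_val i)); rewrite spanE.
  by apply: eq_bigr => j _; rewrite mxE enum_rankK.
have Mfull : row_full M.
  rewrite -sub1mx; apply/row_subP => i.
  have [k k0 /IM[c]] := Ifull (of_coords h (row i 1%:M)).
  rewrite -raddfMn => /(of_coords_inj h_size) /= kc.
  have k0' : (k%:R : rat) != 0 by rewrite pnatr_eq0 -lt0n.
  by rewrite -(scalerK k0' (row i 1%:M)) scaler_nat kc scalemx_sub // submxMl.
have [C Cu [X [Y [MX CY]]]] := int_lattice_basis Mfull.
exists C => // x; rewrite IM; split=> [] [c ->].
  by exists (c *m X); rewrite /lattice_map map_mxM -mulmxA -MX.
by exists (c *m Y); rewrite /lattice_map map_mxM -mulmxA -CY.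
Qed.

(** The Z-basis of the lattice serves as a set of R-generators. *)
Lemma lattice_fractional_ideal (I : set K) (C : 'M[rat]_n) : C \in unitmx ->
    (forall x, I x <-> exists v, x = lattice_map h C v) ->
    (forall a x, R a -> I x -> I (a * x)) ->
  is_fractional_ideal R I.
Proof.
move=> Cu IC IR; split.
- split=> // [|x y /IC[v ->] /IC[w ->]].
    by apply/IC; exists 0; rewrite raddf0.
  by apply/IC; exists (v + w); rewrite raddfD.
- exists n, (fun i => lattice_map h C (delta_mx 0 i)).
  apply/seteqP; split=> x /=.
    move=> /IC[v ->]; exists (fun i => (v 0 i)%:~R); last exact: lattice_map_sum.
    by move=> i; apply: frobenius_order_int.
  move=> [a Ra ->]; apply: (big_ind I) => [|y z /IC[v ->] /IC[w ->]|i _].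
  + by apply/IC; exists 0; rewrite raddf0.
  + by apply/IC; exists (v + w); rewrite raddfD.
  + by apply: IR => //; apply/IC; exists (delta_mx 0 i).
- move=> x; have [k k0 [v kv]] := lattice_map_full h_size Cu x.
  by exists k => //; apply/IC; exists v.
Qed.

End FrobeniusOrder.

(** * The equivalence *)

Section FullyFaithful.
Variables (C D : category) (F : functor C D).
Hypothesis F_full : forall (X Y : C) (g : hom (F X) (F Y)), exists f, fmap F f = g.
Hypothesis F_faithful :
  forall (X Y : C) (f f' : hom X Y), fmap F f = fmap F f' -> f = f'.
Hypothesis F_ess_surj : forall Y : D, exists (X : C) (u : hom (F X) Y), is_iso u.

Lemma equivalence_of_fully_faithful : is_equivalence F.
Proof.
have [G0 G0_iso] := choice F_ess_surj.
pose u Y : hom (F (G0 Y)) Y := projT1 (cid (G0_iso Y)).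
have u_iso Y : is_iso (u Y) := projT2 (cid (G0_iso Y)).
pose v Y : hom Y (F (G0 Y)) := projT1 (cid (u_iso Y)).
have vu Y : comp (v Y) (u Y) = idm (F (G0 Y)) by have [] := projT2 (cid (u_iso Y)).
have uv Y : comp (u Y) (v Y) = idm Y by have [] := projT2 (cid (u_iso Y)).
pose pre X Y (g : hom (F X) (F Y)) : hom X Y := projT1 (cid (F_full g)).
have preK X Y (g : hom (F X) (F Y)) : fmap F (pre X Y g) = g.
  exact: (projT2 (cid (F_full g))).
pose G1 X Y (f : hom X Y) : hom (G0 X) (G0 Y) := pre _ _ (comp (v Y) (comp f (u X))).
have G_id X : G1 X X (idm X) = idm (G0 X).
  by apply: F_faithful; rewrite preK comp_idl vu fmap_id.
have G_comp X Y Z (g : hom Y Z) (f : hom X Y) :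
    G1 _ _ (comp g f) = comp (G1 _ _ g) (G1 _ _ f).
  apply: F_faithful; rewrite fmap_comp !preK.
  by rewrite !compA -(compA _ (u Y) (v Y)) uv comp_idr.
exists (Functor G_id G_comp); split.
  exists (fun X => pre _ _ (u (F X))); split=> [X|X Y f] /=.
    exists (pre _ _ (v (F X))); split; apply: F_faithful;
      by rewrite fmap_comp !preK fmap_id.
  by apply: F_faithful; rewrite !fmap_comp !preK !compA uv comp_idl.
exists u; split=> [Y|X Y f] /=; first by exists (v Y).
by rewrite preK !compA uv comp_idl.
Qed.

End FullyFaithful.

Section Realization.
Variables (q : nat) (h : {poly rat}).
Local Notation K := (quotient_algebra h).
Local Notation alpha := (in_quotient h 'X).
Local Notation R := (frobenius_order q h).

Definition realizes (M : frob_module q h) (phi : {additive M -> K})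
    (I : set K) : Prop :=
  [/\ injective phi, forall t, phi (frob M t) = alpha * phi t &
      forall x, I x <-> exists t, x = phi t].

(** Through the embeddings phi and phi', the map g of ideals is the map f of modules. *)
Definition induces (M M' : frob_module q h) (phi : M -> K) (phi' : M' -> K)
    (I I' : fractional_ideal R) (f : M -> M') (g : fi_set I -> fi_set I') : Prop :=
  forall t (x : fi_set I), val x = phi t -> val (g x) = phi' (f t).

Lemma fractional_ideal_val M phi (I : fractional_ideal R) (x : fi_set I) :
  @realizes M phi I -> exists t, val x = phi t.
Proof. by case=> _ _ IE; apply/IE/set_mem/(valP x). Qed.

Lemma fractional_ideal_elt (I : fractional_ideal R) x : fi_set I x -> exists y : fi_set I, val y = x.
Proof. by move=> Ix; exists (SigSub (mem_set Ix)). Qed.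

Lemma induces_uniq M M' phi phi' (I I' : fractional_ideal R) f (g g' : fi_hom I I') :
  @realizes M phi I -> @induces M M' phi phi' I I' f g ->
    induces phi phi' f g' ->
  g = g'.
Proof.
move=> MI fg fg'; apply: fi_hom_eq => x; apply: val_inj.
by have [t xt] := fractional_ideal_val x MI; rewrite (fg _ _ xt) (fg' _ _ xt).
Qed.

Hypotheses (q_gt0 : (0 < q)%N).
Hypothesis h_roots :
  forall z : algC, root (map_poly ratr h) z -> z * z^* = q%:R.

(** R acts on M: multiplication by a on the image of phi comes from an element s of M
   that also represents the action of a on f t.  For a = beta this is V t, and the
   identity follows by cancelling alpha. *)
Lemma realized_frobenius_order M phi M' phi' (I I' : set K) (f : fm_hom M M') :
    @realizes M phi I -> @realizes M' phi' I' ->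
  forall a, R a -> forall t, exists s, phi s = a * phi t /\ phi' (f s) = a * phi' (f t).
Proof.
move=> [_ phiF _] [_ phi'F _] a Ra; elim/frobenius_order_ind: a / Ra.
- by move=> t; exists t; rewrite !mul1r.
- move=> a b Pa Pb t; have [s [sa sa']] := Pa t; have [s' [sb sb']] := Pb t.
  by exists (s - s'); rewrite !raddfB /= sa sb sa' sb' !mulrBl.
- move=> a b Pa Pb t; have [s [sb sb']] := Pb t; have [s' [sa sa']] := Pa s.
  by exists s'; rewrite sa sb sa' sb' !mulrA.
- by move=> t; exists (frob M t); rewrite phiF fm_homP phi'F.
- move=> b ab t; have [V FV] := verP M; exists (V t).
  split; apply: (alpha_inj q_gt0 h_roots); rewrite mulrA ab mulr_natl.
    by rewrite -phiF FV raddfMn.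
  by rewrite -phi'F -fm_homP FV !raddfMn.
Qed.

Lemma induced_hom_exists M phi M' phi' (I I' : fractional_ideal R) (f : fm_hom M M') :
    @realizes M phi I -> @realizes M' phi' I' ->
  exists g : fi_hom I I', induces phi phi' f g.
Proof.
move=> MI MI'; have [phi_inj _ IE] := MI; have [_ _ IE'] := MI'.
have fx (x : fi_set I) :
    exists y : fi_set I', forall t, val x = phi t -> val y = phi' (f t).
  have [t xt] := fractional_ideal_val x MI.
  have [|y yt] := @fractional_ideal_elt I' (phi' (f t)); first by apply/IE'; exists (f t).
  by exists y => s; rewrite xt => /phi_inj <-.
have [g gP] := choice fx.
suff g_lin (a : K) (x y z : fi_set I) : R a -> val z = a * val x + val y ->
    val (g z) = a * val (g x) + val (g y).
  by exists (FiHom g_lin) => t x; apply: gP.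
move=> Ra; have [t xt] := fractional_ideal_val x MI; have [s ys] := fractional_ideal_val y MI.
have [t' [ta ta']] := realized_frobenius_order f MI MI' Ra t.
rewrite xt ys -ta -raddfD => /gP ->.
by rewrite (gP _ _ xt) (gP _ _ ys) -ta' -!raddfD.
Qed.

Lemma induced_hom_full M phi M' phi' (I I' : fractional_ideal R) (g : fi_hom I I') :
    @realizes M phi I -> @realizes M' phi' I' ->
  exists f : fm_hom M M', induces phi phi' f g.
Proof.
move=> MI MI'; have [phi_inj phiF IE] := MI; have [phi'_inj phi'F IE'] := MI'.
have [R1 RB _] := frobenius_order_subring q h.
have gx t : exists s, forall x : fi_set I, val x = phi t -> val (g x) = phi' s.
  have [|x xt] := @fractional_ideal_elt I (phi t); first by apply/IE; exists t.
  have [s gs] := fractional_ideal_val (g x) MI'.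
  by exists s => y yt; rewrite -gs; congr (val (g _)); apply: val_inj; rewrite yt.
have [f fP] := choice gx.
have lift t : exists x : fi_set I, val x = phi t by apply: fractional_ideal_elt; apply/IE; exists t.
have fB : zmod_morphism f.
  move=> t s; have [x xt] := lift t; have [y ys] := lift s.
  have [z zts] := lift (t - s).
  have RN1 : R (-1) by rewrite -sub0r; apply: RB => //; apply: frobenius_order0.
  have zE : val z = -1 * val y + val x by rewrite zts xt ys raddfB mulN1r addrC.
  apply: phi'_inj; rewrite raddfB /= -(fP _ _ xt) -(fP _ _ ys) -(fP _ _ zts).
  by rewrite (fi_homP g RN1 zE) mulN1r addrC.
pose fA : {additive M -> M'} := HB.pack f (GRing.isZmodMorphism.Build _ _ f fB).
have fF t : fA (frob M t) = frob M' (fA t).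
  have [x xt] := lift t; have [y yFt] := lift (frob M t); have [o o0] := lift 0.
  have yE : val y = alpha * val x + val o by rewrite yFt xt o0 raddf0 addr0 phiF.
  apply: phi'_inj; rewrite phi'F /= -(fP _ _ xt) -(fP _ _ yFt).
  rewrite (fi_homP g (@frobenius_order_alpha q h) yE) (fP _ _ o0).
  by have -> : f 0 = 0 := raddf0 fA; rewrite raddf0 addr0.
by exists (FmHom fF) => t x; apply: fP.
Qed.

Hypotheses (h_monic : h \is monic) (sq : square_free h).

(** A cyclic vector v identifies the row vector v f(A) with the class of f, and the
   change of basis is the inverse of the matrix with rows v A^i. *)
Lemma cyclic_coordinates n (A : 'M[rat]_n) : char_poly A = h ->
  exists2 C : 'M[rat]_n, C \in unitmx &
    forall w, alpha * of_coords h (w *m C) = of_coords h (w *m A *m C).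
Proof.
case: n A => [|n] A Ah.
  exists 1%:M => [|w]; first exact: unitmx1.
  by rewrite [w *m _]thinmx0 [_ *m _ *m _]thinmx0 raddf0 mulr0.
have [v vh] := cyclic_vector_exists Ah sq.
have [P Pu PE] := krylov_basis Ah vh.
exists (invmx P) => [|w]; first by rewrite unitmx_inv.
apply/eqP; rewrite -rmorphM -in_quotient_eq; apply/vh.
rewrite rmorphB /= mulmxBr -PE mulmxKV // mulrC horner_mxM mulmxA -PE mulmxKV //.
by rewrite horner_mx_X subrr.
Qed.

(** The image of T is stable under beta because alpha phi(V t) = phi(F V t) = q phi(t). *)
Lemma frob_module_realized (M : frob_module q h) :
  exists (phi : {additive M -> K}) (I : fractional_ideal R), realizes phi I.
Proof.
have [n [b [A [b_bij bF _ Ah]]]] := frobP M.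
have h_size : size h = n.+1 by rewrite -Ah size_char_poly.
have [C Cu CA] := cyclic_coordinates Ah.
have [c bK cK] := b_bij.
have phiB : zmod_morphism (lattice_map h C \o c).
  move=> t s /=; rewrite -raddfB; congr lattice_map; apply: (can_inj bK).
  by rewrite raddfB /= !cK.
pose phi : {additive M -> K} := HB.pack (lattice_map h C \o c)
  (GRing.isZmodMorphism.Build _ _ _ phiB).
have phiE t : phi t = lattice_map h C (c t) by [].
pose I : set K := [set x | exists t, x = phi t]%classic.
have phiF t : phi (frob M t) = alpha * phi t.
  rewrite !phiE -{1}[t]cK bF bK /lattice_map CA.
  by rewrite map_mxM.
have phi_inj : injective phi.
  by move=> t s /(lattice_map_inj h_size Cu)/(can_inj cK).
have IE x : I x <-> exists v, x = lattice_map h C v.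
  split=> [[t ->]|[v ->]]; first by exists (c t).
  by exists (b v); rewrite phiE bK.
have II : is_fractional_ideal R I.
  apply: (lattice_fractional_ideal h_size Cu IE).
  move=> a x Ra; apply: (stable_frobenius_order _ _ _ _ Ra).
  - by exists 0; rewrite raddf0.
  - by move=> _ _ [t ->] [s ->]; exists (t - s); rewrite raddfB.
  - by move=> _ [t ->]; exists (frob M t); rewrite phiF.
  - move=> beta ab _ [t ->]; have [V FV] := verP M; exists (V t).
    apply: (alpha_inj q_gt0 h_roots); rewrite mulrA ab mulr_natl.
    by rewrite -phiF FV raddfMn.
by exists phi, (FractionalIdeal II).
Qed.

Variable H : {poly int}.
Hypothesis hH : h = map_poly intr H.

(** The object is Z^n with the matrices of alpha and beta as F and V. *)
Lemma fractional_ideal_realized (I : fractional_ideal R) :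
  exists (M : frob_module q h) (phi : {additive M -> K}), realizes phi I.
Proof.
have h_size : size h = (size h).-1.+1.
  by rewrite prednK // size_poly_gt0 squarefree_neq0.
move: (size h).-1 h_size => n h_size.
have [C Cu IC] :=
  fractional_ideal_lattice q_gt0 h_monic sq hH h_size h_roots (fi_setP I).
have [[_ _ IR] _ _] := fi_setP I.
have matrix_of a : R a -> exists A : 'M[int]_n, forall v,
    a * lattice_map h C v = lattice_map h C (v *m A).
  move=> Ra; apply: lattice_mul_matrix => v.
  by apply/IC; apply: IR => //; apply/IC; exists v.
have [beta ab] := verschiebung_exists q_gt0 h_roots.
have [A AE] := matrix_of _ (@frobenius_order_alpha q h).
have [B BE] := matrix_of _ (frobenius_order_beta ab).
have Ah := lattice_char_poly h_size Cu h_monic AE.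
have frobA : exists (m : nat) (b : {additive 'rV[int]_m -> 'rV[int]_n})
      (A' : 'M[int]_m),
    [/\ bijective b, forall v, mulmxr A (b v) = b (v *m A'),
        semisimple_mx (map_mx intr A') & char_poly (map_mx intr A') = h].
  exists n, idfun, A; split=> //; first by exists idfun.
  case: (n) (A) Ah => [|n'] A' Ah'; last exact: semisimple_squarefree Ah' sq.
  by move=> U _; exists 0; split; rewrite ?sub0mx ?thinmx0 // [_ :&: _]thinmx0.
have verB : exists V : {additive 'rV[int]_n -> 'rV[int]_n}, forall t,
    mulmxr A (V t) = t *+ q.
  exists (mulmxr B) => t; apply: (lattice_map_inj h_size Cu).
  by rewrite /= -AE -BE mulrA ab mulr_natl raddfMn.
exists (FrobModule frobA verB), (lattice_map h C); split=> //.
  exact: lattice_map_inj.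
by move=> t; rewrite /= AE.
Qed.

(** Embeddings of the objects in K are chosen once and for all; a morphism is sent to
   the unique map of ideals that it induces. *)
Lemma frob_module_equivalence :
  exists Psi : functor (frob_module_cat q h) (fractional_ideal_cat R),
    is_equivalence Psi.
Proof.
pose phi M := projT1 (cid (frob_module_realized M)).
have phi_ex M : exists I : fractional_ideal R, realizes (phi M) I.
  exact: projT2 (cid (frob_module_realized M)).
pose I M := projT1 (cid (phi_ex M)).
have MI M : realizes (phi M) (I M) := projT2 (cid (phi_ex M)).
pose F1 M M' (f : fm_hom M M') : fi_hom (I M) (I M') :=
  projT1 (cid (induced_hom_exists f (MI M) (MI M'))).
have F1P M M' (f : fm_hom M M') : induces (phi M) (phi M') f (F1 _ _ f).
  exact: projT2 (cid (induced_hom_exists f (MI M) (MI M'))).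
have F_id M : F1 M M (fm_id M) = fi_id (I M).
  exact: induces_uniq (MI M) (F1P _ _ _) _.
have F_comp M1 M2 M3 (g : fm_hom M2 M3) (f : fm_hom M1 M2) :
    F1 _ _ (fm_comp g f) = fi_comp (F1 _ _ g) (F1 _ _ f).
  by apply: induces_uniq (MI M1) (F1P _ _ _) _ => t x xt; apply/F1P/F1P.
pose Psi : functor (frob_module_cat q h) (fractional_ideal_cat R) :=
  @Functor (frob_module_cat q h) (fractional_ideal_cat R) I F1 F_id F_comp.
exists Psi; apply: equivalence_of_fully_faithful.
- move=> M M' g; have [f fg] := induced_hom_full g (MI M) (MI M').
  by exists f; apply: induces_uniq (MI M) (F1P _ _ _) fg.
- move=> M M' f f' ff'; apply: fm_hom_eq => t; have [_ _ IE] := MI M.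
  have [phi'_inj _ _] := MI M'; apply: phi'_inj.
  have [|x xt] := @fractional_ideal_elt (I M) (phi M t); first by apply/IE; exists t.
  rewrite -(F1P _ _ f _ _ xt) -(F1P _ _ f' _ _ xt).
  by have -> : F1 M M' f = F1 M M' f' := ff'.
- move=> J; have [M [phi' MJ]] := fractional_ideal_realized J.
  have [u uP] := induced_hom_exists (fm_id M) (MI M) MJ.
  have [v vP] := induced_hom_exists (fm_id M) MJ (MI M).
  exists M, u, v; split.
    apply: (induces_uniq (M' := M) (phi' := phi M) (f := id) (MI M)) => // t x xt.
    exact: vP (uP _ _ xt).
  apply: (induces_uniq (M' := M) (phi' := phi') (f := id) MJ) => // t x xt.
  exact: uP (vP _ _ xt).
Qed.

End Realization.

Theorem theorem4p3 (p : nat) (p_pr : prime p) (r : nat) (r_gt0 : (0 < r)%N)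
    (h : {poly rat}) :
  weil p_pr r h ->
  square_free h ->
  ordinary p_pr h \/ (r = 1%N /\ ~ has_real_root h) ->
  exists Psi : functor (frob_module_cat (p ^ r)%N h)
                       (fractional_ideal_cat (frobenius_order (p ^ r)%N h)),
    is_equivalence Psi.
Proof.
move=> /weil_frobenius[h_monic [H hH] h_roots] sq _.
have q_gt0 : (0 < p ^ r)%N by rewrite expn_gt0 prime_gt0.
exact: (frob_module_equivalence q_gt0 h_roots h_monic sq hH).
Qed.
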